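(* Let $H$ be a complex Hilbert space and let $T=A+\mathrm{i}B\in B(H)$, where $A,B\in B(H)$ are self-adjoint. If $T^3$ and $T^2$ are self-adjoint and $A\geq 0$ (or $A\leq 0$), then $T$ is self-adjoint.
   Context: $H$ is a complex Hilbert space (possibly infinite-dimensional) and $B(H)$ is the algebra of bounded linear operators from $H$ into itself. For $S\in B(H)$, $S\geq 0$ (positive) means $\langle Sx,x\rangle\geq 0$ for all $x\in H$, and $S\leq 0$ means $-S\geq 0$. *)

(* Defs.v *)
From HB Require Import structures.
From mathcomp Require Import all_boot all_order all_algebra.
From mathcomp Require Import complex.
From mathcomp Require Import all_classical all_reals all_analysis.

Set Implicit Arguments.
Unset Strict Implicit.
Unset Printing Implicit Defensive.

Import Order.TTheory GRing.Theory Num.Theory.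
Import numFieldNormedType.Exports.

Local Open Scope ring_scope.
Local Open Scope complex_scope.

(* A complex Hilbert space is a complete normed space over R[i] whose norm
   comes from an inner product.  The form is linear in its first argument and
   conjugate-linear in its second one. *)
HB.mixin Record CompleteNormedModule_isHilbert (R : realType) H
    of CompleteNormedModule R[i] H := {
  inner : {dot H for @Num.conj R[i]};
  normr_inner : forall x : H, `|x| ^+ 2 = inner x x
}.

#[short(type="hilbertType")]
HB.structure Definition Hilbert (R : realType) :=
  {H of CompleteNormedModule R[i] H & CompleteNormedModule_isHilbert R H}.

Section operators.
Context {R : realType} {H : hilbertType R}.

(* By linear_boundedP, this is the existence of M with |T x| <= M |x|. *)
Definition bounded_op (T : {linear H -> H}) : Prop :=
  bounded_near T (nbhs (0 : H)).

Definition adjoint_of (S S' : H -> H) : Prop :=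
  forall x y : H, inner (S x) y = inner x (S' y).

Lemma adjoint_of_uniq (S S1 S2 : H -> H) :
  adjoint_of S S1 -> adjoint_of S S2 -> S1 =1 S2.
Proof.
move=> S1P S2P y; apply/eqP; rewrite -subr_eq0 -(dnorm_eq0 inner) linearB /=.
by rewrite -S1P -S2P subrr.
Qed.

Definition self_adjoint (S : H -> H) : Prop := adjoint_of S S.

(* In R[i], 0 <= z means that z is real and nonnegative. *)
Definition positive_op (S : H -> H) : Prop :=
  forall x : H, 0 <= inner (S x) x.

Definition negative_op (S : H -> H) : Prop := positive_op (\- S).

End operators.

(* Main.v *)
Require Import Defs.
From mathcomp Require Import all_boot all_order all_algebra.
From mathcomp Require Import complex.
From mathcomp Require Import all_classical all_reals all_analysis.
From mathcomp Require Import ring.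

Import Order.TTheory GRing.Theory Num.Theory.
Local Open Scope ring_scope.
Local Open Scope complex_scope.

(** The adjoint of [T = A + iB] is [A - iB], so self-adjointness of [T^2] means
    [(A + iB)^2 = (A - iB)^2], that is, [AB = - BA].

    The heart of the matter is that a positive [A] and a self-adjoint [B] which
    anticommute satisfy [AB = 0] ([anticomm_mul0]).  The reason is that [B^2] is
    seen with opposite signs by two forms.  It is positive for the inner product,
    but with respect to the positive form [[x, y] = <A x, y>] the operator [B] is
    skew, so there [B^2] is negative.  For small [c > 0] the operator
    [K = 1 - c B^2] is therefore a contraction of [H], whereas [[K x, K x]]
    exceeds [[x, x]] by at least [2 c [B x, B x]].  As [K] commutes with [B], the
    gain never shrinks under iteration, so [[K^n x, K^n x]] grows at least
    linearly in [n] with slope [2 c [B x, B x]]; but it is bounded, because [A]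
    is bounded and [K] contracts.  The slope is hence zero, and [A (B x) = 0]
    because a positive operator vanishes where its quadratic form does
    ([positive_op_eq0]).

    If [A] is negative, the same holds with [- A] in place of [A].  Once
    [AB = BA = 0], one has [T^3 = A^3 - i B^3], so self-adjointness of [T^3]
    gives [B^3 = 0]; a self-adjoint nilpotent operator is zero, and [T = A]. *)

Lemma complex_le_natmul_eq0 (R : realType) (z a : R[i]) :
  0 <= z -> (forall n, z *+ n <= a) -> z = 0.
Proof.
rewrite lecE /= => /andP[/eqP Imz Rez] za.
have Rza n : complex.Re z *+ n <= complex.Re a.
  by have := za n; rewrite lecE [complex.Re (_ *+ _)]raddfMn => /andP[].
suff Rez0 : complex.Re z = 0 by case: z Imz Rez0 {Rez Rza za} => /= ? ? -> ->.
apply/eqP; rewrite eq_le Rez andbT.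
rewrite leNgt; apply/negP => z_gt0.
have a_ge0 : 0 <= complex.Re a by have := Rza 0%N; rewrite mulr0n.
have /archi_boundP : 0 <= complex.Re a / complex.Re z by rewrite divr_ge0.
by rewrite ltr_pdivrMr// mulr_natl ltNge Rza.
Qed.

Section Operators.
Context {R : realType} {H : hilbertType R}.
Implicit Types (A B S : {linear H -> H}) (x y : H).

Lemma innerDl x y z : inner (x + y) z = inner x z + inner y z.
Proof. exact: linearDl. Qed.

Lemma innerBl x y z : inner (x - y) z = inner x z - inner y z.
Proof. exact: linearBl. Qed.

Lemma innerBr x y z : inner x (y - z) = inner x y - inner x z.
Proof. exact: linearBr. Qed.

Lemma innerNl x y : inner (- x) y = - inner x y.
Proof. exact: linearNl. Qed.

Lemma innerNr x y : inner x (- y) = - inner x y.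
Proof. exact: linearNr. Qed.

Lemma innerZl a x y : inner (a *: x) y = a * inner x y.
Proof. exact: linearZl_LR. Qed.

Lemma innerZr a x y : inner x (a *: y) = a^*%R * inner x y.
Proof. exact: linearZr_LR. Qed.

Lemma inner_ge0 x : 0 <= inner x x.
Proof. exact: dnorm_ge0. Qed.

Lemma inner_eq0 x : inner x x = 0 -> x = 0.
Proof. by move/eqP; rewrite dnorm_eq0 => /eqP. Qed.

Lemma bounded_op_inner S : bounded_op S ->
  exists2 c : R[i], 0 < c & forall x, inner (S x) (S x) <= c * inner x x.
Proof.
move=> /linear_boundedP/pinfty_ex_gt0[M M0 SM].
exists (M ^+ 2) => [|x]; first by rewrite exprn_gt0.
by rewrite -!normr_inner -exprMn lerXn2r ?nnegrE ?mulr_ge0 // ltW.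
Qed.

(** Expanding [0 <= |S x - x|^2] gives [2 <S x, x> <= |S x|^2 + |x|^2]. *)
Lemma self_adjoint_form_bounded S : self_adjoint S -> bounded_op S ->
  exists2 c : R[i], 0 < c & forall x, inner (S x) x <= c * inner x x.
Proof.
move=> sS /bounded_op_inner[c c0 Sc].
exists ((c + 1) / 2) => [|x]; first by rewrite divr_gt0 ?addr_gt0.
have := inner_ge0 (S x - x).
rewrite innerBl !innerBr -(sS x x) opprB addrACA -opprD subr_ge0.
rewrite mulrAC ler_pdivlMr// mulr_natr mulr2n => /le_trans; apply.
by rewrite mulrDl mul1r lerD2r.
Qed.

(** Evaluate the form at [x - t A x]: with [<A x, x> = 0] it is
    [- 2 t |A x|^2 + t^2 <A (A x), A x>].  If [c] bounds the form of [A] and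
    [t = c^-1], this is at most [- t |A x|^2], and it has to be nonnegative. *)
Lemma positive_op_eq0 A x : self_adjoint A -> bounded_op A -> positive_op A ->
  inner (A x) x = 0 -> A x = 0.
Proof.
move=> sA bA A_ge0 Ax0; apply: inner_eq0.
have [c c0 cA] := self_adjoint_form_bounded _ sA bA.
have cR : c^-1^*%R = c^-1 by rewrite conj_Creal// gtr0_real// invr_gt0.
have := A_ge0 (x - c^-1 *: A x).
rewrite (linearB A) (linearZ_LR A) innerBl !innerBr !innerZl !innerZr cR Ax0 sub0r.
rewrite (sA (A x)).
set d := inner (A x) (A x); rewrite opprB addrCA -opprD -mulr2n subr_ge0 => le1.
apply/eqP; rewrite eq_le inner_ge0 andbT -(pmulr_rle0 _ (_ : 0 < c^-1)) ?invr_gt0//.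
suff : c^-1 * d *+ 2 <= c^-1 * d by rewrite mulr2n gerDl.
by apply: le_trans le1 _; rewrite ler_pM2l ?invr_gt0// ler_pdivrMl.
Qed.

Section Anticommuting.
Variables A B : {linear H -> H}.
Hypotheses (sA : self_adjoint A) (sB : self_adjoint B).
Hypothesis anticomm : forall x, A (B x) = - B (A x).

(** Because [B] is skew for the form [<A x, y>], the cross terms, which would
    lower the norm in the inner product, raise it here. *)
Lemma form_sub_sqr (c : R[i]) x : c^*%R = c ->
  inner (A (x - c *: B (B x))) (x - c *: B (B x)) =
  inner (A x) x + (c * inner (A (B x)) (B x)) *+ 2
   + c ^+ 2 * inner (A (B (B x))) (B (B x)).
Proof.
move=> cR; rewrite (linearB A) (linearZ_LR A) innerBl !innerBr !innerZl !innerZr cR.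
have -> : inner (A x) (B (B x)) = - inner (A (B x)) (B x).
  by rewrite -sB anticomm innerNl opprK.
have -> : inner (A (B (B x))) x = - inner (A (B x)) (B x).
  by rewrite anticomm innerNl sB.
by ring.
Qed.

Hypotheses (bA : bounded_op A) (bB : bounded_op B) (A_ge0 : positive_op A).

(** The bounded quantity [<A (K^n x), K^n x>], with [K = 1 - c B^2], grows at
    least linearly with slope [2 c <A (B x), B x>]. *)
Lemma anticomm_mul0 x : A (B x) = 0.
Proof.
apply: positive_op_eq0 => //.
have [b b0 bBb] := bounded_op_inner _ bB.
have [a a0 aAa] := self_adjoint_form_bounded _ sA bA.
(* With [c |B|^2 <= 1], [K] is a contraction of the inner product. *)
pose c := b^-1; have c0 : 0 < c by rewrite invr_gt0.
have cR : c^*%R = c by rewrite conj_Creal// gtr0_real.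
pose K y := y - c *: B (B y).
have BK y : B (K y) = K (B y) by rewrite /K linearB linearZ.
have K_le y : inner (K y) (K y) <= inner y y.
  rewrite /K innerBl !innerBr !innerZl !innerZr cR -(sB y) (sB (B y) y).
  set d := inner (B y) (B y).
  apply: (@le_trans _ _ (inner y y - c * d)).
    by rewrite gerDl oppr_le0 subr_ge0 ler_pM2l// /c ler_pdivrMl.
  by rewrite gerDl oppr_le0 mulr_ge0 ?inner_ge0 ?ltW.
have AK_ge y : inner (A y) y + (c * inner (A (B y)) (B y)) *+ 2
    <= inner (A (K y)) (K y).
  by rewrite form_sub_sqr// lerDl mulr_ge0 ?A_ge0 ?exprn_ge0 ?ltW.
have AK_mono y : inner (A y) y <= inner (A (K y)) (K y).
  apply: le_trans (AK_ge y).
  by rewrite lerDl mulrn_wge0// mulr_ge0 ?A_ge0 ?ltW.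
(* The gain at each step is that of the first one, since [B] commutes with [K]
   and [<A y, y>] does not decrease along [K]. *)
have AKn n : forall y, inner (A y) y + (c * inner (A (B y)) (B y)) *+ 2 *+ n
    <= inner (A (iter n K y)) (iter n K y).
  elim: n => [|n IH] y; first by rewrite mulr0n addr0.
  rewrite iterSr; apply: le_trans (IH (K y)).
  rewrite mulrS addrA lerD ?AK_ge//.
  by rewrite !lerMn2r /= ler_pM2l// BK AK_mono orbT.
have Kn n : inner (iter n K x) (iter n K x) <= inner x x.
  elim: n => //= n; exact: le_trans (K_le _).
suff : (c * inner (A (B x)) (B x)) *+ 2 = 0.
  by move/eqP; rewrite mulrn_eq0 /= mulf_eq0 gt_eqF//= => /eqP.
apply: (complex_le_natmul_eq0 _ _ (a * inner x x)) => [|n].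
  by rewrite mulrn_wge0// mulr_ge0 ?A_ge0 ?ltW.
apply: le_trans (_ : a * inner (iter n K x) (iter n K x) <= _).
  apply: le_trans (aAa _).
  by apply: le_trans (AKn n x); rewrite lerDr A_ge0.
by rewrite ler_pM2l.
Qed.

End Anticommuting.

Lemma eq_opp_eq0 x : x = - x -> x = 0.
Proof.
move/eqP; rewrite -addr_eq0 -mulr2n -scaler_nat scaler_eq0 pnatr_eq0 /=.
exact/eqP.
Qed.

Lemma self_adjoint_sqr_eq0 S x : self_adjoint S -> S (S x) = 0 -> S x = 0.
Proof. by move=> sS SSx; apply: inner_eq0; rewrite sS SSx (linear0r inner). Qed.

End Operators.

Theorem theorem2p3 (R : realType) (H : hilbertType R)
  (T A B : {linear H -> H})
  (hT : bounded_op T) (hA : bounded_op A) (hB : bounded_op B)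
  (sA : self_adjoint A) (sB : self_adjoint B)
  (TAB : forall x : H, T x = A x + 'i *: B x)
  (sT3 : self_adjoint (T \o T \o T))
  (sT2 : self_adjoint (T \o T))
  (signA : positive_op A \/ negative_op A) :
  self_adjoint T.
Proof.
pose T' x := A x - 'i *: B x.
have adjT : adjoint_of T T'.
  move=> x y; rewrite TAB /T' innerDl innerBr innerZl innerZr sA sB.
  by rewrite conjCi mulNr opprK.
have adjT2 : adjoint_of (T \o T) (T' \o T') by move=> x y /=; rewrite !adjT.
have adjT3 : adjoint_of (T \o T \o T) (T' \o T' \o T').
  by move=> x y /=; rewrite !adjT.
have T2E := adjoint_of_uniq sT2 adjT2.
have T3E := adjoint_of_uniq sT3 adjT3.
have anticomm x : A (B x) = - B (A x).
  have := T2E x; rewrite /T' /= !TAB.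
  rewrite !(linearB A, linearB B, linearD A, linearD B).
  rewrite !(linearZ_LR A, linearZ_LR B).
  rewrite scalerDr scalerBr -!addrA => /addrI.
  rewrite opprB addrA [RHS]addrCA [RHS]addrC => /addIr.
  rewrite -opprD -scalerDr => /eq_opp_eq0/eqP.
  by rewrite scaler_eq0 (negPf (neq0Ci _)) addr_eq0 => /eqP.
have AB0 x : A (B x) = 0.
  case: signA => A_pos; first exact: anticomm_mul0.
  apply: oppr_inj; rewrite oppr0; apply: (anticomm_mul0 (\- A)%R B) => //.
  - by move=> y z; rewrite /= innerNl innerNr sA.
  - by move=> y; rewrite /= anticomm (linearN B).
  - apply/linear_boundedP; have /linear_boundedP := hA.
    by apply: filterS => r Ar y; rewrite /= normrN; exact: Ar.
have BA0 x : B (A x) = 0 by apply: oppr_inj; rewrite -anticomm AB0 oppr0.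
have B3 x : B (B (B x)) = 0.
  have := T3E x; rewrite /T' /= !TAB.
  rewrite !(linearB A, linearB B, linearD A, linearD B,
            linearZ_LR A, linearZ_LR B, AB0, BA0).
  rewrite !(linear0, scaler0, addr0, add0r, subr0, sub0r).
  rewrite !scalerN !opprK => /addrI/eq_opp_eq0/eqP.
  by rewrite !scaler_eq0 (negPf (neq0Ci _)) => /eqP.
have B0 x : B x = 0.
  by apply: self_adjoint_sqr_eq0 => //; apply: self_adjoint_sqr_eq0.
have TA x : T x = A x by rewrite TAB B0 scaler0 addr0.
by move=> x y; rewrite !TA.
Qed.
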